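(* Let $n\geq 1$, let $M_n$ be the monoid defined below and set $\Delta:=\rho_n^{n+1}\in M_n$. Then $(M_n,\Delta)$ is a Garside monoid. Consequently $M_n$ embeds in its group of fractions $G(M_n)$, which is the group defined by the same presentation as $M_n$; this group $G(M_n)$ is isomorphic to the $(n,n+1)$-torus knot group $G(n,n+1)=\langle x,y \mid x^n=y^{n+1}\rangle$.
   Context: For $n\geq 1$, $M_n$ denotes the monoid with generators $\rho_1,\dots,\rho_n$ and relations $\rho_1\rho_n\rho_i=\rho_{i+1}\rho_n$ for $1\leq i\leq n-1$. In a monoid $M$, $a$ left-divides $c$ (and $c$ is a right-multiple of $a$) if $c=ab$ for some $b\in M$; similarly for right-divisibility/left-multiples. Lcms and gcds are taken with respect to these divisibility relations. A Garside monoid is a pair $(M,\Delta)$ with $M$ a monoid and $\Delta\in M$ such that: (1) $M$ is left- and right-cancellative; (2) divisibility in $M$ is Noetherian, i.e. there is $\lambda:M\to\mathbb{Z}_{\geq 0}$ with $\lambda(ab)\geq\lambda(a)+\lambda(b)$ for all $a,b$ and $\lambda(a)\neq 0$ for $a\neq 1$; (3) any two elements of $M$ admit a left-lcm, a right-lcm, a left-gcd and a right-gcd; (4) the left-divisors and the right-divisors of $\Delta$ coincide and generate $M$; (5) the set of divisors of $\Delta$ is finite. *)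

(* Defs.v *)
(* Monoids and groups given by presentations are
   modelled as words over a finite alphabet modulo the congruence generated by
   the defining relations. *)
From Stdlib Require List.
From mathcomp Require Import all_boot.
Set Implicit Arguments. Unset Strict Implicit. Unset Printing Implicit Defensive.

Section Presentations.
Variable A : Type.

Inductive mcong (R : seq A -> seq A -> Prop) : seq A -> seq A -> Prop :=
| mc_rel u v : R u v -> mcong R u v
| mc_refl u : mcong R u u
| mc_sym u v : mcong R u v -> mcong R v u
| mc_trans u v w : mcong R u v -> mcong R v w -> mcong R u w
| mc_ctx p u v s : mcong R u v -> mcong R (p ++ u ++ s) (p ++ v ++ s).

Variable eqv : seq A -> seq A -> Prop.  (* equality in the monoid *)

Definition ldiv (a c : seq A) := exists b, eqv (a ++ b) c.
Definition rdiv (a c : seq A) := exists b, eqv (b ++ a) c.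

Definition cancellative :=
  (forall a b c, eqv (a ++ b) (a ++ c) -> eqv b c) /\
  (forall a b c, eqv (b ++ a) (c ++ a) -> eqv b c).

Definition noetherian :=
  exists lambda : seq A -> nat,
    (forall a b, eqv a b -> lambda a = lambda b) /\
    (forall a b, lambda a + lambda b <= lambda (a ++ b)) /\
    (forall a, ~ eqv a [::] -> lambda a <> 0).

Definition is_lcm_l (a b m : seq A) :=
  ldiv a m /\ ldiv b m /\ forall c, ldiv a c -> ldiv b c -> ldiv m c.
Definition is_gcd_l (a b g : seq A) :=
  ldiv g a /\ ldiv g b /\ forall d, ldiv d a -> ldiv d b -> ldiv d g.
Definition is_lcm_r (a b m : seq A) :=
  rdiv a m /\ rdiv b m /\ forall c, rdiv a c -> rdiv b c -> rdiv m c.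
Definition is_gcd_r (a b g : seq A) :=
  rdiv g a /\ rdiv g b /\ forall d, rdiv d a -> rdiv d b -> rdiv d g.

Definition lcms_gcds :=
  forall a b, (exists m, is_lcm_l a b m) /\ (exists m, is_lcm_r a b m) /\
              (exists g, is_gcd_l a b g) /\ (exists g, is_gcd_r a b g).

Definition garside (Delta : seq A) :=
  cancellative /\ noetherian /\ lcms_gcds /\
  (forall a, ldiv a Delta <-> rdiv a Delta) /\
  (forall w, exists ds : seq (seq A),
      (forall d, Stdlib.Lists.List.In d ds -> ldiv d Delta) /\ eqv w (flatten ds)) /\
  (exists s : seq (seq A), forall a, ldiv a Delta ->
      exists b, Stdlib.Lists.List.In b s /\ eqv a b).

(* Group presentations: letters (a, true) = a, (a, false) = a^-1. *)
Definition pos (w : seq A) : seq (A * bool) := map (fun a => (a, true)) w.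
Definition ginv (w : seq (A * bool)) : seq (A * bool) :=
  rev (map (fun x => (x.1, ~~ x.2)) w).

Inductive grel (R : seq A -> seq A -> Prop) : seq (A * bool) -> seq (A * bool) -> Prop :=
| gr_rel u v : R u v -> grel R (pos u) (pos v)
| gr_inv a b : grel R [:: (a, b); (a, ~~ b)] [::].

End Presentations.

Definition gcong (A : Type) (R : seq A -> seq A -> Prop) :=
  @mcong (A * bool) (grel R).

Definition ext (A B : Type) (f : A -> seq (B * bool)) (w : seq (A * bool)) :
  seq (B * bool) :=
  flatten (map (fun x => if x.2 then f x.1 else ginv (f x.1)) w).

Definition pres_group_iso (A B : Type) (RA : seq A -> seq A -> Prop)
    (RB : seq B -> seq B -> Prop) :=
  exists (f : A -> seq (B * bool)) (g : B -> seq (A * bool)),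
    (forall w1 w2, gcong RA w1 w2 -> gcong RB (ext f w1) (ext f w2)) /\
    (forall w1 w2, gcong RB w1 w2 -> gcong RA (ext g w1) (ext g w2)) /\
    (forall w, gcong RA (ext g (ext f w)) w) /\
    (forall w, gcong RB (ext f (ext g w)) w).

(* Relations of M_n: generator rho_{i+1} is the ordinal of value i.
   rho_1 rho_n rho_i = rho_{i+1} rho_n for 1 <= i <= n-1. *)
Definition Mrel (n : nat) (u v : seq 'I_n) : Prop :=
  exists i : nat, 1 <= i <= n.-1 /\
    map val u = [:: 0; n.-1; i.-1] /\ map val v = [:: i; n.-1].

Definition Meq (n : nat) := mcong (@Mrel n).

Lemma predn_lt (n : nat) : 0 < n -> n.-1 < n.
Proof. by rewrite ltn_predL. Qed.

Definition rho_top (n : nat) (hn : 0 < n) : 'I_n := Ordinal (predn_lt hn).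

Definition Delta (n : nat) (hn : 0 < n) : seq 'I_n := nseq n.+1 (rho_top hn).

(* Torus knot group G(n, n+1) = < x, y | x^n = y^(n+1) >, x = false, y = true *)
Definition Trel (n : nat) (u v : seq bool) : Prop :=
  u = nseq n false /\ v = nseq n.+1 true.

(* Main.v *)
Require Import Defs.
From Stdlib Require Import ZArith Setoid Morphisms Classical.
From mathcomp Require Import all_boot zify.

Set Implicit Arguments. Unset Strict Implicit. Unset Printing Implicit Defensive.

(** In the group put x = rho_1 rho_n, y = rho_n and z = Delta. The relations say
    rho_i = x^i y^-i and x^n = y^(n+1) = z, which is central already in M_n;
    this gives the torus knot group, and every generator divides z on both
    sides.

    The group acts on the normal forms z^k y^b x^(a_1) y^(b_1) ... of the torus
    knot group. Define the height of a normal form as k plus the number of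
    syllables x^a y^b with a + b > n. Left multiplication by rho_i preserves
    nonnegativity of the height, and an element of nonnegative height is the
    value of an explicit word in the rho_i which is compatible, modulo the
    relations of M_n, with that multiplication. Hence M_n embeds in the group,
    as the elements of nonnegative height, and is cancellative.

    Reading off normal forms, the right-lcm of rho_i and rho_j is rho_j y^i for
    i < j. Cancellation, a length function and common multiples then give all
    right-lcms, hence left-gcds; the duality a <-> a^-1 z^N exchanges left and
    right divisibility. *)

(** * Congruences on words, and gcds from lcms *)

#[local] Instance mcong_equivalence (A : Type) (R : seq A -> seq A -> Prop) :
  Equivalence (mcong R).
Proof.
split; [exact: mc_refl | exact: mc_sym | exact: mc_trans].
Qed.

#[local] Hint Resolve mc_refl : core.

#[local] Instance mcong_cat (A : Type) (R : seq A -> seq A -> Prop) :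
  Proper (mcong R ==> mcong R ==> mcong R) cat.
Proof.
move=> u u' Hu v v' Hv; apply: (@mc_trans _ _ _ (u' ++ v)).
  exact: (@mc_ctx _ R [::]).
by have := @mc_ctx _ R u' v v' [::] Hv; rewrite !cats0.
Qed.

#[local] Instance mcong_cons (A : Type) (R : seq A -> seq A -> Prop) (a : A) :
  Proper (mcong R ==> mcong R) (cons a).
Proof. by move=> u v Huv; rewrite -cat1s -[a :: v]cat1s Huv. Qed.

Lemma pos_cat (A : Type) (u v : seq A) : pos (u ++ v) = pos u ++ pos v.
Proof. exact: map_cat. Qed.

Lemma mem_In (T : eqType) (x : T) (s : seq T) : x \in s -> List.In x s.
Proof. by elim: s => //= y s IH; rewrite inE => /orP [/eqP ->|/IH]; [left | right]. Qed.

Lemma is_lcm_sym (A : Type) (eqv : seq A -> seq A -> Prop) a b c :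
  is_lcm_l eqv a b c -> is_lcm_l eqv b a c.
Proof. by case=> h1 [h2 h3]; split=> //; split=> // d *; apply: h3. Qed.

(** A common divisor [d0] that misses another common divisor is replaced by their lcm, which still
    divides [a] and [b] and is strictly heavier; weights stay at most [w a], so this stops. *)
Lemma gcd_of_lcm (T : Type) (D : T -> T -> Prop) (w : T -> nat) :
  (forall a b c, D a b -> D b c -> D a c) ->
  (forall a b, D a b -> w a <= w b) ->
  (forall a b, D a b -> ~ D b a -> w a < w b) ->
  (forall a b, exists c, D a c /\ D b c /\ forall d, D a d -> D b d -> D c d) ->
  forall a b d0, D d0 a -> D d0 b ->
  exists g, D g a /\ D g b /\ forall d, D d a -> D d b -> D d g.
Proof.
move=> tr wle wlt lcm a b d0.
elim: {d0}_.+1 {-2}d0 (ltnSn (w a - w d0)) => // k IH d0 Hk Ha Hb.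
have [[d [da [db dd0]]]|none] := classic (exists d, D d a /\ D d b /\ ~ D d d0).
  have [c [h1 [h2 h3]]] := lcm d d0.
  have ca := h3 _ da Ha.
  apply: (IH c) => //; last exact: h3.
  have := wle _ _ ca; have : w d0 < w c by apply: wlt => // /(tr _ _ _ h1).
  lia.
exists d0; do 2!split=> //; move=> d da db; apply: NNPP => Hd.
by apply: none; exists d.
Qed.

(** * The monoid M_n *)

Section Monoid.
Variable m : nat.
Local Notation n := m.+1.
Local Notation "u =M v" := (@Meq n u v) (at level 70).

#[local] Instance Meq_equivalence : Equivalence (@Meq n).
Proof. exact: mcong_equivalence. Qed.
#[local] Hint Extern 0 (Meq _ _) => exact: mc_refl : core.
#[local] Instance Meq_cat : Proper (@Meq n ==> @Meq n ==> @Meq n) cat.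
Proof. exact: mcong_cat. Qed.
#[local] Instance Meq_cons (a : 'I_n) : Proper (@Meq n ==> @Meq n) (cons a).
Proof. exact: mcong_cons. Qed.

(* rho i is the generator $\rho_i$, meaningful for 1 <= i <= n. *)
Definition rho (i : nat) : 'I_n := inord i.-1.
Definition Yp (j : nat) : seq 'I_n := nseq j (rho n).
Definition Xp (j : nat) : seq 'I_n := flatten (nseq j [:: rho 1; rho n]).
Definition Dp (j : nat) : seq 'I_n := Yp (n.+1 * j).

(** * Powers of x, y and Delta in M_n *)

Lemma Yp_add i j : Yp (i + j) = Yp i ++ Yp j.
Proof. by rewrite /Yp nseqD. Qed.

Lemma Xp_add i j : Xp (i + j) = Xp i ++ Xp j.
Proof. by rewrite /Xp nseqD flatten_cat. Qed.

Lemma Xp_succ i : Xp i.+1 = Xp i ++ Xp 1.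
Proof. by rewrite -[i.+1]addn1 Xp_add. Qed.

Lemma Dp_add i j : Dp (i + j) = Dp i ++ Dp j.
Proof. by rewrite /Dp mulnDr Yp_add. Qed.

Lemma Dp1 : Dp 1 = Yp n.+1.
Proof. by rewrite /Dp muln1. Qed.

Lemma ord_rho (a : 'I_n) : a = rho a.+1.
Proof. by apply: val_inj; rewrite /= inordK ?ltn_ord. Qed.

Lemma rho_val i : 0 < i <= n -> val (rho i) = i.-1.
Proof. by move=> H; rewrite /= inordK //; lia. Qed.

Lemma X_rho1 i : 0 < i < n -> Xp 1 ++ [:: rho i] =M [:: rho i.+1; rho n].
Proof.
move=> Hi; apply: mc_rel; exists i; split; first by lia.
by split; rewrite /= !inordK //; lia.
Qed.

Lemma X_rho j i : 0 < i -> i + j <= n -> Xp j ++ [:: rho i] =M rho (i + j) :: Yp j.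
Proof.
elim: j => [|j IH] Hi Hij; first by rewrite addn0.
rewrite -[j.+1]add1n Xp_add -catA IH; [|lia|lia].
rewrite -cat1s catA X_rho1; last lia.
by rewrite addnCA add1n.
Qed.

Lemma XpE i : 0 < i <= n -> Xp i =M rho i :: Yp i.
Proof.
case: i => // i Hi; rewrite Xp_succ.
rewrite -[Xp 1]/([:: rho 1] ++ Yp 1) catA X_rho; [|lia|lia].
by rewrite add1n cat_cons -Yp_add addn1.
Qed.

Lemma XpnE : Xp n =M Dp 1.
Proof. by rewrite Dp1 XpE ?leqnn //. Qed.

Lemma rho_Y_X i : 0 < i <= n -> [:: rho i] ++ Yp i ++ Xp (n - i) =M Dp 1.
Proof.
by move=> Hi; rewrite catA cat1s -XpE // -Xp_add subnKC ?XpnE //; lia.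
Qed.

Lemma Y_X_rho i : 0 < i <= n -> (Yp i ++ Xp (n - i)) ++ [:: rho i] =M Dp 1.
Proof.
move=> Hi; rewrite -catA X_rho; [|lia|lia].
rewrite subnKC; last lia.
rewrite -[rho n :: _]/(Yp 1 ++ _) -!Yp_add Dp1.
by have -> : i + (1 + (n - i)) = n.+1 by lia.
Qed.

(** The word y^i x^(n-i) complements rho_i to Delta on either side, so both products equal rho_i y^i
    x^(n-i) rho_i. *)
Lemma D_rho i : 0 < i <= n -> Dp 1 ++ [:: rho i] =M rho i :: Dp 1.
Proof. by move=> Hi; rewrite -{1}(rho_Y_X Hi) -catA Y_X_rho. Qed.

Lemma Dp1_central u : Dp 1 ++ u =M u ++ Dp 1.
Proof.
elim: u => [|a u IH]; first by rewrite cats0.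
by rewrite -cat1s catA (ord_rho a) D_rho ?ltn_ord // cat_cons IH.
Qed.

Lemma Dp_central j u : Dp j ++ u =M u ++ Dp j.
Proof.
elim: j => [|j IH]; first by rewrite /Dp muln0 cats0.
by rewrite -[j.+1]addn1 Dp_add -catA Dp1_central catA IH catA.
Qed.

Lemma Dp_pull j u v : u ++ Dp j ++ v =M Dp j ++ u ++ v.
Proof. by rewrite catA -Dp_central catA. Qed.

(* State k b [:: (a_1, b_1); ...; (a_r, b_r)] stands for the element
   z^k y^b x^(a_1) y^(b_1) ... x^(a_r) y^(b_r) of the torus knot group; the
   well-formed states below are the normal forms of the central extension
   of Z/n * Z/(n+1). *)
Inductive state := State of Z & nat & seq (nat * nat).

(** * Normal forms and the action of x, y and z *)

Definition credit (p : nat * nat) : nat := n < p.1 + p.2.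
Definition credits (l : seq (nat * nat)) : nat := sumn (map credit l).
Definition height (s : state) : Z :=
  let: State k _ l := s in (k + Z.of_nat (credits l))%Z.

(** Only the last syllable may have y-exponent 0; elsewhere two powers of x would merge. *)
Fixpoint wfl (l : seq (nat * nat)) : bool :=
  if l is (a, b) :: l' then
    [&& 0 < a, a < n, b <= n, (0 < b) || nilp l' & wfl l']
  else true.
Definition wf (s : state) : bool :=
  let: State _ b l := s in (b <= n) && wfl l.

Definition push (k : Z) (a b : nat) (l : seq (nat * nat)) : state :=
  if a == n then State (k + 1) b l else State k 0 ((a, b) :: l).

Definition xact (s : state) : state :=
  match s with
  | State k 0 ((a, b) :: l) => push k a.+1 b l
  | State k b l => push k 1 b l
  end.

Definition yact (s : state) : state :=
  let: State k b l := s in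
  if b == n then State (k + 1) 0 l else State k b.+1 l.

(* y^(-i), for i <= n *)
Definition ydown (i : nat) (s : state) : state :=
  let: State k b l := s in
  if i <= b then State k (b - i) l else State (k - 1) (n.+1 + b - i) l.

Definition zact (d : Z) (s : state) : state :=
  let: State k b l := s in State (k + d) b l.

Lemma xact_y k b l : (0 < b) || nilp l -> xact (State k b l) = push k 1 b l.
Proof. by case: b => // /nilP ->. Qed.

Lemma iter_xact_push j k a b l : a + j <= n ->
  iter j xact (push k a b l) = push k (a + j) b l.
Proof.
elim: j => [|j IH] H; first by rewrite addn0.
rewrite iterS IH; last lia.
by rewrite {1}/push ifN ?addnS //; lia.
Qed.

Lemma iter_xact_y j k b l : 0 < j <= n -> (0 < b) || nilp l ->
  iter j xact (State k b l) = push k j b l.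
Proof.
case: j => // j H y; rewrite iterSr xact_y // iter_xact_push; last lia.
by rewrite add1n.
Qed.

Lemma iter_xact_n s : wf s -> iter n xact s = zact 1 s.
Proof.
case: s => k b l /andP [Hb Hl].
have [y|] := boolP ((0 < b) || nilp l).
  by rewrite iter_xact_y ?leqnn // /push eqxx.
case: b Hb l Hl => // _ [|[a b] l] //= /and5P [a0 an bn y Hl] _.
have E : State k 0 ((a, b) :: l) = push k a b l by rewrite /push ifN //; lia.
(* The first n - a steps complete x^a to x^n = z; the other a steps rebuild the syllable behind the
   z. *)
have -> : xact (iter m xact (State k 0 ((a, b) :: l)))
        = iter a xact (iter (n - a) xact (push k a b l)).
  by rewrite -iterD -E subnKC // ltnW.
rewrite iter_xact_push; last lia.
rewrite subnKC; last lia.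
rewrite /push eqxx iter_xact_y //; last lia.
by rewrite /push ifN //; lia.
Qed.

Lemma iter_yact j k b l : b + j <= n -> iter j yact (State k b l) = State k (b + j) l.
Proof.
elim: j => [|j IH] H; first by rewrite addn0.
by rewrite iterS IH /= ?ifN ?addnS //; lia.
Qed.

Lemma ydownK i s : i <= n -> wf s -> iter i yact (ydown i s) = s.
Proof.
case: s => k b l Hi /andP [Hb _]; rewrite /ydown.
case: leqP => H; first by rewrite iter_yact ?subnK //; lia.
(* Split at the carry: i - b - 1 steps bring the exponent up to n, the next one wraps it to 0 and
   gives back the z, and b steps remain. *)
have -> : i = b + (1 + (i - b.+1)) by lia.
rewrite !iterD iter_yact; last lia.
have -> : n.+1 + b - (b + (1 + (i - b.+1))) + (i - b.+1) = n by lia.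
rewrite /= eqxx iter_yact //; congr State; lia.
Qed.

Lemma yactK i s : i <= n -> wf s -> ydown i (iter i yact s) = s.
Proof.
case: s => k b l Hi /andP [Hb _].
have [H|H] := leqP (b + i) n.
  by rewrite iter_yact //= ifT ?addnK //; lia.
have -> : i = (i - (n - b).+1) + (1 + (n - b)) by lia.
rewrite !iterD iter_yact; last lia.
rewrite subnKC // /= eqxx iter_yact; last lia.
rewrite /ydown ifN; last lia.
congr State; lia.
Qed.

Lemma xact_z d s : xact (zact d s) = zact d (xact s).
Proof.
case: s => k [|b] [|[a b'] l]; rewrite /= /push; case: ifP => //= _;
  congr State; lia.
Qed.

Lemma iter_xact_z d j s : iter j xact (zact d s) = zact d (iter j xact s).
Proof. by elim: j => // j IH; rewrite !iterS IH xact_z. Qed.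

Lemma zactK d s : zact d (zact (- d) s) = s.
Proof. by case: s => k b l; rewrite /zact; congr State; lia. Qed.

Lemma wf_push k a b l : 0 < a <= n -> b <= n -> (0 < b) || nilp l -> wfl l ->
  wf (push k a b l).
Proof.
move=> Ha Hb y Hl; rewrite /push; case: eqP => E /=; first by rewrite Hb.
by rewrite Hb y Hl !andbT; lia.
Qed.

Lemma wf_xact s : wf s -> wf (xact s).
Proof.
case: s => k b l /andP [Hb Hl].
have [y|] := boolP ((0 < b) || nilp l).
  by rewrite xact_y //; apply: wf_push.
case: b Hb l Hl => // _ [|[a b] l] //= /and5P [a0 an bn y Hl] _.
exact: wf_push.
Qed.

Lemma wf_iter_xact j s : wf s -> wf (iter j xact s).
Proof. by move=> H; elim: j => // j; rewrite iterS; apply: wf_xact. Qed.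

Lemma wf_yact s : wf s -> wf (yact s).
Proof.
by case: s => k b l /andP [Hb Hl] /=; case: eqP => //= ?; rewrite Hl andbT; lia.
Qed.

Lemma wf_iter_yact j s : wf s -> wf (iter j yact s).
Proof. by move=> H; elim: j => // j; rewrite iterS; apply: wf_yact. Qed.

Lemma wf_ydown i s : wf s -> wf (ydown i s).
Proof.
by case: s => k b l /andP [Hb Hl] /=; case: leqP => //= ?; rewrite Hl andbT; lia.
Qed.

Lemma wf_zact d s : wf (zact d s) = wf s.
Proof. by case: s. Qed.

Definition ract (i : nat) (s : state) : state := iter i xact (ydown i s).
(** This is rho_i^-1 = y^i x^-i, with x^-i realised as z^-1 x^(n-i). *)
Definition rinv (i : nat) (s : state) : state :=
  iter i yact (zact (-1) (iter (n - i) xact s)).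

Lemma wf_ract i s : wf s -> wf (ract i s).
Proof. by move=> H; apply/wf_iter_xact/wf_ydown. Qed.

Lemma wf_rinv i s : wf s -> wf (rinv i s).
Proof. by move=> H; apply: wf_iter_yact; rewrite wf_zact; apply: wf_iter_xact. Qed.

Lemma ractK i s : i <= n -> wf s -> rinv i (ract i s) = s.
Proof.
move=> Hi H; rewrite /rinv /ract -iterD subnK //.
rewrite iter_xact_n ?wf_ydown //.
by rewrite -[zact 1 _]/(zact (- -1) _) zactK ydownK.
Qed.

Lemma rinvK i s : i <= n -> wf s -> ract i (rinv i s) = s.
Proof.
move=> Hi H; rewrite /rinv /ract yactK ?wf_zact ?wf_iter_xact //.
rewrite iter_xact_z -iterD subnKC // iter_xact_n //.
by case: (s) => k b l; rewrite /zact; congr State; lia.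
Qed.

(** * Words of M_n for normal forms of nonnegative height *)

Definition syl (p : nat * nat) : seq 'I_n :=
  if n < p.1 + p.2 then rho p.1 :: Yp (p.1 + p.2 - n.+1) else Xp p.1 ++ Yp p.2.
Definition nfl (l : seq (nat * nat)) : seq 'I_n := flatten (map syl l).
(* Every positive element z^k y^b x^a1 y^b1 ... is written as a word of the
   monoid by using up one factor 1/z in each syllable x^a y^b with a + b > n:
   there x^a y^b / z = rho_a y^(a+b-n-1). *)
Definition nf (s : state) : seq 'I_n :=
  let: State _ b l := s in Dp (Z.to_nat (height s)) ++ Yp b ++ nfl l.

Lemma creditE a b : credit (a, b) = (n < a + b).
Proof. by []. Qed.

Lemma sylE a b : syl (a, b) =
  if n < a + b then rho a :: Yp (a + b - n.+1) else Xp a ++ Yp b.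
Proof. by []. Qed.

Lemma Dp0 : Dp 0 = [::].
Proof. by rewrite /Dp muln0. Qed.

(** If a + b = n, then x^(a+1) y^b = rho_(a+1) y^(n+1) = rho_(a+1) z: a Delta is released exactly
    when the credit is earned. *)
Lemma X_syl a b : a < n -> b <= n ->
  Xp 1 ++ syl (a, b) =M Dp (credit (a.+1, b) - credit (a, b)) ++ syl (a.+1, b).
Proof.
move=> Ha Hb; rewrite !creditE !sylE.
case: (ltnP n (a + b)) => H1; case: (ltnP n (a.+1 + b)) => H2; try lia.
- rewrite -(cat1s (rho a)) (catA (Xp 1)) X_rho1; last lia.
  by rewrite Dp0 addSn subSn //; lia.
- have E : a.+1 + b - n.+1 = 0 by lia.
  rewrite E catA -Xp_add add1n XpE; last lia.
  rewrite cat_cons -Yp_add.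
  have -> : a.+1 + b = n.+1 by lia.
  by rewrite -Dp1 -[rho a.+1 :: Dp 1]cat1s -Dp_central.
- by rewrite Dp0 cat0s catA -Xp_add add1n.
Qed.

Lemma syl_n b : b <= n -> syl (n, b) =M Dp (1 - credit (n, b)) ++ Yp b.
Proof.
move=> Hb; rewrite !creditE !sylE.
case: ltnP => H; last by rewrite XpnE.
rewrite Dp0 cat0s -cat1s -[[:: _]]/(Yp 1) -Yp_add.
by have -> : 1 + (n + b - n.+1) = b by lia.
Qed.

Lemma height_push k a b l : 0 < a <= n -> b <= n ->
  (k + Z.of_nat (credits l) + Z.of_nat (credit (a, b)) <= height (push k a b l))%Z.
Proof.
move=> Ha Hb; rewrite /push; case: eqP => [->|_] /=; last first.
  by rewrite /credits /=; lia.
by rewrite /credit; case: ltnP => /=; lia.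
Qed.

Lemma credit_le1 p : credit p <= 1.
Proof. exact: leq_b1. Qed.

Lemma credit_mono a b : credit (a, b) <= credit (a.+1, b).
Proof. by rewrite /credit /=; do 2![case: ltnP => ?]; lia. Qed.

(** [v] is the height counted before x^n is turned into z, so that one formula covers both outcomes
    of [push]. *)
Lemma nf_push k a b l v : b <= n ->
  Z.of_nat v = (k + Z.of_nat (credits l) + Z.of_nat (credit (a, b)))%Z ->
  nf (push k a b l) =M Dp v ++ syl (a, b) ++ nfl l.
Proof.
move=> Hb Hv; rewrite /push; case: eqP => [E|_] /=; last first.
  by have -> : Z.to_nat (k + Z.of_nat (credits ((a, b) :: l))) = v
    by move: Hv; rewrite /credits /=; lia.
rewrite E in Hv *; have Hc := credit_le1 (n, b).
rewrite syl_n // !catA -Dp_add -!catA.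
by have -> : Z.to_nat (k + 1 + Z.of_nat (credits l)) = v + (1 - credit (n, b)) by lia.
Qed.

Lemma X_nf_push k a b l v : a < n -> b <= n ->
  Z.of_nat v = (k + Z.of_nat (credits l) + Z.of_nat (credit (a, b)))%Z ->
  Xp 1 ++ Dp v ++ syl (a, b) ++ nfl l =M nf (push k a.+1 b l).
Proof.
move=> Ha Hb Hv; rewrite Dp_pull (catA (Xp 1)) X_syl // -catA catA -Dp_add.
rewrite (@nf_push _ _ _ _ (v + (credit (a.+1, b) - credit (a, b)))) //.
by have := credit_mono a b; lia.
Qed.

Lemma height_xact s : wf s -> (height s <= height (xact s))%Z.
Proof.
case: s => k b l /andP [Hb Hl].
have [y|] := boolP ((0 < b) || nilp l).
  by rewrite xact_y //; have /= := @height_push k 1 b l isT Hb; lia.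
case: b Hb l Hl => // _ [|[a b] l] //= /and5P [a0 an bn y Hl] _.
have /= := @height_push k a.+1 b l an bn.
by have := credit_mono a b; rewrite /credits /=; lia.
Qed.

Lemma nf_xact s : wf s -> (0 <= height s)%Z -> Xp 1 ++ nf s =M nf (xact s).
Proof.
case: s => k b l /andP [Hb Hl] Hh.
have [y|] := boolP ((0 < b) || nilp l).
  (* This is the case a = 0: y^b is read as the syllable (0, b), which earns no credit since b <=
     n. *)
  rewrite xact_y // -X_nf_push //; last first.
    have -> : credit (0, b) = 0 by rewrite /credit; case: ltnP => /=; lia.
    by rewrite Z.add_0_r -[RHS]Z2Nat.id.
  by rewrite /syl ltnNge Hb.
case: b Hb l Hl Hh => // _ [|[a b] l] //= /and5P [a0 an bn y Hl] Hh _.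
rewrite -X_nf_push //.
by rewrite Z2Nat.id // /credits /=; lia.
Qed.

Lemma height_yact s : (height s <= height (yact s))%Z.
Proof. by case: s => k b l /=; case: eqP => _ /=; lia. Qed.

Lemma nf_yact s : wf s -> (0 <= height s)%Z -> Yp 1 ++ nf s =M nf (yact s).
Proof.
case: s => k b l /andP [Hb Hl] Hh.
rewrite {1}/nf Dp_pull (catA (Yp 1)) -Yp_add /yact; case: eqP => [->|_] //.
rewrite /nf.
have -> : Z.to_nat (height (State (k + 1) 0 l)) = Z.to_nat (height (State k b l)) + 1.
  by move: Hh => /=; lia.
by rewrite Dp_add Dp1 -catA.
Qed.

Lemma iter_xact_nf j s : wf s -> (0 <= height s)%Z ->
  (0 <= height (iter j xact s))%Z /\ Xp j ++ nf s =M nf (iter j xact s).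
Proof.
move=> Hs Hh; elim: j => [|j [IH1 IH2]]; first by [].
have W := wf_iter_xact j Hs; rewrite iterS; split.
  exact: Z.le_trans IH1 (height_xact W).
by rewrite -nf_xact // -IH2 catA -Xp_add add1n.
Qed.

Lemma iter_yact_nf j s : wf s -> (0 <= height s)%Z ->
  (0 <= height (iter j yact s))%Z /\ Yp j ++ nf s =M nf (iter j yact s).
Proof.
move=> Hs Hh; elim: j => [|j [IH1 IH2]]; first by [].
have W := wf_iter_yact j Hs; rewrite iterS; split.
  by have := @height_yact (iter j yact s); lia.
by rewrite -nf_yact // -IH2 catA -Yp_add add1n.
Qed.

Lemma ract_small i k b l : 0 < i <= n -> b < i ->
  ract i (State k b l) = push (k - 1) i (n.+1 + b - i) l.
Proof.
move=> Hi Hb; rewrite /ract /= ifN; last lia.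
by rewrite iter_xact_y //; lia.
Qed.

(** If i <= b, a factor y^i splits off and rho_i y^i = x^i. If b < i, the z borrowed to form y^-i is
    repaid by the credit of x^i y^(n+1+b-i), whose exponents sum to n+1+b > n. *)
Lemma ract_nf i s : 0 < i <= n -> wf s -> (0 <= height s)%Z ->
  (0 <= height (ract i s))%Z /\ rho i :: nf s =M nf (ract i s).
Proof.
case: s => k b l Hi Hs Hh; case: (leqP i b) => H.
  have E : ydown i (State k b l) = State k (b - i) l by rewrite /= H.
  have W := wf_ydown i Hs.
  have Hh' : (0 <= height (ydown i (State k b l)))%Z by rewrite E.
  have [h1 h2] := iter_xact_nf i W Hh'; split=> //.
  rewrite -h2 XpE // -cat1s -(cat1s _ (Yp i)) -catA.
  have [_ ->] := iter_yact_nf i W Hh'.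
  by rewrite ydownK //; lia.
have C : credit (i, n.+1 + b - i) = 1 by rewrite /credit /=; case: ltnP; lia.
rewrite ract_small //; split.
  have Hb : n.+1 + b - i <= n by lia.
  by have := @height_push (k - 1) _ _ l Hi Hb; move: Hh; rewrite C /=; lia.
rewrite (@nf_push _ _ _ _ (Z.to_nat (height (State k b l)))); [| lia |]; last first.
  by rewrite Z2Nat.id // C /=; lia.
rewrite /syl ifT /=; last lia.
rewrite -cat1s Dp_pull.
by have -> : i + (n.+1 + b - i) - n.+1 = b by lia.
Qed.

(** * Action of group words, and the embedding of M_n *)

Definition letter (x : 'I_n * bool) (s : state) : state :=
  if x.2 then ract x.1.+1 s else rinv x.1.+1 s.
Definition act (w : seq ('I_n * bool)) (s : state) : state := foldr letter s w.
Definition origin : state := State 0 0 [::].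

Lemma act_cat u v s : act (u ++ v) s = act u (act v s).
Proof. exact: foldr_cat. Qed.

Lemma wf_act w s : wf s -> wf (act w s).
Proof.
move=> Hs; elim: w => //= -[a []] w IH; rewrite /letter /=.
  exact: wf_ract.
exact: wf_rinv.
Qed.

(** The state reached from [origin] thus determines the class of a word in M_n; as the action
    factors through the group, M_n embeds there. *)
Lemma act_pos u : (0 <= height (act (pos u) origin))%Z /\ u =M nf (act (pos u) origin).
Proof.
elim: u => [|a u [IH1 IH2]]; first by split=> //=; rewrite Dp0.
have W : wf (act (pos u) origin) by apply: wf_act.
have [h1 h2] := @ract_nf a.+1 _ (ltn_ord a) W IH1.
by split=> //=; rewrite /letter /= -h2 -ord_rho -IH2.
Qed.

Lemma act_eq_Meq u v : act (pos u) origin = act (pos v) origin -> u =M v.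
Proof.
move=> E; have [_ ->] := act_pos u; have [_ ->] := act_pos v.
by rewrite E.
Qed.

Lemma ract_n s : wf s -> ract n s = yact s.
Proof.
move=> Hs; rewrite /ract iter_xact_n ?wf_ydown //.
case: s Hs => k b l /andP [Hb _] /=; case: eqP => [->|E].
  by rewrite leqnn /zact subnn.
rewrite ifN; last lia.
by rewrite /zact; congr State; lia.
Qed.

Lemma ydown_yact i s : i < n -> wf s -> ydown i.+1 (yact s) = ydown i s.
Proof.
case: s => k b l Hi /andP [Hb _] /=; case: eqP => [->|E] /=.
  by rewrite ifT ?ltn0 /=; [congr State; lia | lia].
by rewrite ltnS; case: ifP => H; congr State; lia.
Qed.

(** Since rho_n acts as y, which cancels a factor y^-1 on its left, both sides act as x^(i+1)
    y^-i. *)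
Lemma act_relation i s : 0 < i < n -> wf s ->
  ract 1 (ract n (ract i s)) = ract i.+1 (ract n s).
Proof.
move=> Hi Hs; rewrite !ract_n ?wf_ract // /ract (@ydown_yact i) //; last lia.
have W : wf (iter i xact (ydown i s)) by apply/wf_iter_xact/wf_ydown.
rewrite !iterS (@ydown_yact 0) //.
by case: (iter i xact _) => k b l; rewrite /= subn0.
Qed.

Lemma act_letterK (a : 'I_n) b s : wf s -> letter (a, b) (letter (a, ~~ b) s) = s.
Proof.
move=> Hs; have Ha := ltn_ord a.
by case: b; rewrite /letter /= ?rinvK ?ractK.
Qed.

Lemma gcong_act u v s : gcong (@Mrel n) u v -> wf s -> act u s = act v s.
Proof.
move=> H; elim: H s => {u v}.
- move=> _ _ [u v [i [Hi [Hu Hv]]]|a b] s Hs; last by rewrite /= act_letterK.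
  case: u Hu => [|a [|b [|c [|? ?]]]] //= [Ea Eb Ec].
  case: v Hv => [|a' [|b' [|? ?]]] //= [Ea' Eb'].
  rewrite /letter /= Ea Eb Ec Ea' Eb' prednK; last by lia.
  by apply: act_relation => //; lia.
- by [].
- by move=> u v _ IH s Hs; rewrite IH.
- by move=> u v w _ IH1 _ IH2 s Hs; rewrite IH1 // IH2.
- by move=> p u v q _ IH s Hs; rewrite !act_cat IH // wf_act.
Qed.


Lemma Meq_gcong u v : u =M v -> gcong (@Mrel n) (pos u) (pos v).
Proof.
elim=> {u v} [u v H|u|u v _ IH|u v w _ IH1 _ IH2|p u v s _ IH].
- by apply/mc_rel/gr_rel.
- exact: mc_refl.
- exact: mc_sym.
- exact: mc_trans IH1 IH2.
- by rewrite !pos_cat; apply: mc_ctx.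
Qed.

Lemma gcong_Meq u v : gcong (@Mrel n) (pos u) (pos v) -> u =M v.
Proof. by move=> H; apply: act_eq_Meq; apply: gcong_act. Qed.

Lemma Meq_act u v s : u =M v -> wf s -> act (pos u) s = act (pos v) s.
Proof. by move=> /Meq_gcong; apply: gcong_act. Qed.

(** * Cancellation, common multiples and weight *)

Lemma ract_inj i s t : i <= n -> wf s -> wf t -> ract i s = ract i t -> s = t.
Proof. by move=> Hi Hs Ht E; rewrite -(ractK Hi Hs) E ractK. Qed.

Lemma act_pos_inj u s t : wf s -> wf t -> act (pos u) s = act (pos u) t -> s = t.
Proof.
move=> Hs Ht; elim: u => //= a u IH E; apply: IH.
by apply: (@ract_inj a.+1 _ _ _ _ _ E); rewrite ?ltn_ord ?wf_act.
Qed.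

Lemma Meq_cancel_l a b c : a ++ b =M a ++ c -> b =M c.
Proof.
move=> H; apply: act_eq_Meq; apply: (@act_pos_inj a); rewrite ?wf_act //.
by rewrite -!act_cat -!pos_cat; apply: Meq_act.
Qed.

Lemma Dp_multiple_l u : exists v, u ++ v =M Dp (size u).
Proof.
elim: u => [|a u [v Hv]]; first by exists [::]; rewrite Dp0.
have H : 0 < a.+1 <= n by rewrite ltn_ord.
exists (v ++ Yp a.+1 ++ Xp (n - a.+1)).
rewrite cat_cons catA Hv -cat1s Dp_pull {1}(ord_rho a) rho_Y_X //.
by rewrite -Dp_add addn1.
Qed.

Lemma Dp_comm u v j : u ++ v =M Dp j -> v ++ u =M Dp j.
Proof.
move=> H; apply: (@Meq_cancel_l u).
by rewrite catA H Dp_central.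
Qed.

(** Completing [a] on the right to a power of Delta, which is central, reduces this to left
    cancellation. *)
Lemma Meq_cancel_r a b c : b ++ a =M c ++ a -> b =M c.
Proof.
move=> H; have [v Hv] := Dp_multiple_l a.
apply: (@Meq_cancel_l (Dp (size a))).
by rewrite !Dp_central -Hv !catA H.
Qed.

(** Giving rho_i the weight i makes the relations homogeneous: 1 + n + i = (i + 1) + n. *)
Definition weight (u : seq 'I_n) : nat := sumn (map (fun a : 'I_n => a.+1) u).

Lemma weight_cat u v : weight (u ++ v) = weight u + weight v.
Proof. by rewrite /weight map_cat sumn_cat. Qed.

Lemma weight_Meq u v : u =M v -> weight u = weight v.
Proof.
elim=> {u v} [u v [i [Hi [Hu Hv]]]|u|u v _ IH|u v w _ IH1 _ IH2|p u v s _ IH].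
- have E w : weight w = sumn (map S (map val w)) by rewrite -map_comp.
  by rewrite !E Hu Hv /=; lia.
- by [].
- by [].
- by rewrite IH1.
- by rewrite !weight_cat IH.
Qed.

Lemma weight_eq0 u : weight u = 0 -> u = [::].
Proof. by case: u. Qed.

(** * Lcms and gcds for left divisibility *)

Notation ld := (ldiv (@Meq n)).

(* If y^i does not divide q, then q = y^b q' has height 0 with b < i, and
   p = rho_i^-1 rho_j q begins with y^i x^(j-i) y^(n+1+b-j): this syllable earns
   no credit, so p would have height -1. *)
Lemma rho_common_multiple i j p q : 0 < i -> i < j -> j <= n ->
  rho i :: p =M rho j :: q -> ld (Yp i) q.
Proof.
move=> i0 ij jn H.
have [hq nq] := act_pos q; have [hp _] := act_pos p.
have Wq : wf (act (pos q) origin) by apply: wf_act.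
have Wp : wf (act (pos p) origin) by apply: wf_act.
have E : ract i (act (pos p) origin) = ract j (act (pos q) origin).
  have rE k s : 0 < k <= n -> letter (rho k, true) s = ract k s.
    by move=> Hk; rewrite /letter /= inordK ?prednK //; lia.
  have /= := Meq_act H (isT : wf origin).
  by rewrite !rE //; lia.
move: hp Wp E; set t := act (pos p) origin => hp Wp.
case: (act (pos q) origin) hq nq Wq => k b l hq nq Wq E.
pose r := ydown i (State k b l).
have Wr : wf r by apply: wf_ydown.
have [hr|hr] := Z.lt_ge_cases (height r) 0; last first.
  exists (nf r); rewrite nq.
  have [_ ->] := iter_yact_nf i Wr hr.
  by rewrite ydownK //; lia.
have Hb : b < i.
  by rewrite ltnNge; apply/negP => Hb; move: hr hq; rewrite /r /= Hb /=; lia.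
have {hr} hr : (height (State k b l) = 0)%Z.
  by move: hr hq; rewrite /r /= ifN /=; lia.
pose t' := State (k - 1) i ((j - i, n.+1 + b - j) :: l).
have /andP [bn Hl] := Wq.
have Wt' : wf t' by rewrite /t' /=; apply/and5P; split; rewrite ?Hl; lia.
have Et : t = t'.
  apply: (@ract_inj i); rewrite ?E //; first lia.
  rewrite ract_small //; try lia.
  rewrite /ract /t' /= leqnn subnn.
  have -> : State (k - 1) 0 ((j - i, n.+1 + b - j) :: l)
          = push (k - 1) (j - i) (n.+1 + b - j) l by rewrite /push ifN //; lia.
  by rewrite iter_xact_push subnK //; lia.
move: hp; rewrite Et /t' /height /credits /= creditE.
by move: hr; rewrite /height /credits; case: ltnP => ? /=; lia.
Qed.

(** Both sides equal x^i rho_(j-i). *)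
Lemma rho_multiple i j : 0 < i -> i < j -> j <= n ->
  rho i :: Yp i ++ [:: rho (j - i)] =M rho j :: Yp i.
Proof.
move=> i0 ij jn; rewrite -cat_cons -XpE; last lia.
by rewrite X_rho; [rewrite subnK //; lia | lia | lia].
Qed.

Lemma lcm_rho i j : 0 < i -> i < j -> j <= n ->
  is_lcm_l (@Meq n) [:: rho i] [:: rho j] (rho j :: Yp i).
Proof.
move=> i0 ij jn; split; [|split].
- by exists (Yp i ++ [:: rho (j - i)]); apply: rho_multiple.
- by exists (Yp i).
move=> c [p Hp] [q Hq].
have [s Hs] : ld (Yp i) q by apply: (@rho_common_multiple i j p q) => //; apply: mc_trans Hp (mc_sym Hq).
by exists s; rewrite cat_cons Hs.
Qed.

Lemma lcm_letters (a b : 'I_n) : a <> b -> exists c, is_lcm_l (@Meq n) [:: a] [:: b] c.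
Proof.
move=> H; have Ha := ltn_ord a; have Hb := ltn_ord b.
rewrite (ord_rho a) (ord_rho b); case: (ltngtP a b) => [L|L|/val_inj //].
  by eexists; apply: lcm_rho => //; lia.
by eexists; apply/is_lcm_sym/lcm_rho; lia.
Qed.

Lemma ldiv_refl a : ld a a.
Proof. by exists [::]; rewrite cats0. Qed.

Lemma ldiv_trans a b c : ld a b -> ld b c -> ld a c.
Proof. by case=> x Hx [y Hy]; exists (x ++ y); rewrite catA Hx. Qed.

Lemma ldiv_cat2l x a b : ld (x ++ a) (x ++ b) <-> ld a b.
Proof.
split=> -[y Hy]; exists y; last by rewrite -catA Hy.
by apply: (@Meq_cancel_l x); rewrite catA.
Qed.

#[local] Instance ldiv_Meq : Proper (@Meq n ==> @Meq n ==> iff) ld.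
Proof.
move=> a a' Ha b b' Hb; split=> -[y Hy]; exists y.
  by rewrite -Ha -Hb.
by rewrite Ha Hb.
Qed.

Lemma ldiv_cat a b : ld a (a ++ b).
Proof. by exists b. Qed.

Lemma lcm_cat2l x a b c :
  is_lcm_l (@Meq n) a b c -> is_lcm_l (@Meq n) (x ++ a) (x ++ b) (x ++ c).
Proof.
case=> h1 [h2 h3]; split; [|split]; try exact/ldiv_cat2l.
move=> d [y Hy]; rewrite -Hy -catA !ldiv_cat2l => H; apply: h3 => //.
exact: ldiv_cat.
Qed.

(* Newman-style induction on the common multiple c. For a = s a' and b = t b'
   with distinct letters s and t, let m0 be the lcm of s and t; then the lcm of
   a and b is that of lcm(a, m0) and lcm(b, m0), and each of the three lcms
   involved is, after removing a common prefix, that of two divisors of a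
   shorter element. *)
Lemma lcm_bounded k a b c : weight c < k -> ld a c -> ld b c ->
  exists d, is_lcm_l (@Meq n) a b d.
Proof.
elim: k a b c => // k IH [|s a] [|t b] c Hc Ha Hb.
- by exists [::]; split; [exact: ldiv_refl | split=> //; exact: ldiv_refl].
- by exists (t :: b); split; [exists (t :: b) | split=> //; exact: ldiv_refl].
- by exists (s :: a); split; [exact: ldiv_refl | split=> //; exists (s :: a)].
have shorter w d : 0 < weight w -> w ++ d =M c -> weight d < k.
  by move=> Hw /weight_Meq; rewrite weight_cat; lia.
have strip w u : 0 < weight w -> ld (w ++ u) c -> exists d,
    [/\ w ++ d =M c, weight d < k & ld u d].
  move=> Hw [y Hy]; exists (u ++ y); rewrite catA; split=> //.
    by apply: (shorter w) => //; rewrite catA.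
  exact: ldiv_cat.
have [c1 [E1 W1 D1]] := strip [:: s] a isT Ha.
have [c2 [E2 W2 D2]] := strip [:: t] b isT Hb.
have [est|/eqP nst] := eqVneq s t.
  subst t; have E : c1 =M c2 by apply: (@Meq_cancel_l [:: s]); rewrite E1 E2.
  have {}D2 : ld b c1 by rewrite E.
  have [d Hd] := IH _ _ _ W1 D1 D2.
  exists (s :: d); exact: (@lcm_cat2l [:: s]).
have [m0 [[p Hp] [[q Hq] m0min]]] := lcm_letters nst.
have m0c : ld m0 c by apply: m0min; [rewrite -E1 | rewrite -E2]; exact: ldiv_cat.
have pc1 : ld p c1 by rewrite -(ldiv_cat2l [:: s]) Hp E1.
have qc2 : ld q c2 by rewrite -(ldiv_cat2l [:: t]) Hq E2.
have [e1 H1] := IH _ _ _ W1 D1 pc1.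
have [e2 H2] := IH _ _ _ W2 D2 qc2.
have e1c : ld e1 c1 by case: H1 => _ [_]; apply.
have e2c : ld e2 c2 by case: H2 => _ [_]; apply.
have [A1 [[f1 B1] M1]] := lcm_cat2l [:: s] H1.
have [A2 [[f2 B2] M2]] := lcm_cat2l [:: t] H2.
have {}B1 : m0 ++ f1 =M [:: s] ++ e1 by rewrite -Hp.
have {}B2 : m0 ++ f2 =M [:: t] ++ e2 by rewrite -Hq.
have m0w : 0 < weight m0 by rewrite -(weight_Meq Hp).
have [c3 [E3 W3 F1]] : exists d, [/\ m0 ++ d =M c, weight d < k & ld f1 d].
  by apply: strip => //; rewrite B1 -E1 ldiv_cat2l.
have F2 : ld f2 c3 by rewrite -(ldiv_cat2l m0) B2 E3 -E2 ldiv_cat2l.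
have [f Hf] := IH _ _ _ W3 F1 F2.
have [A3 [B3 M3]] := lcm_cat2l m0 Hf.
exists (m0 ++ f); split; last split.
- by apply: ldiv_trans A1 _; rewrite -B1.
- by apply: ldiv_trans A2 _; rewrite -B2.
move=> d Hs Ht.
have m0d : ld m0 d.
  apply: m0min; [apply: ldiv_trans Hs | apply: ldiv_trans Ht].
    exact: (@ldiv_cat [:: s]).
  exact: (@ldiv_cat [:: t]).
apply: M3; first by rewrite B1; apply: M1 => //; rewrite Hp.
by rewrite B2; apply: M2 => //; rewrite Hq.
Qed.

Lemma lcm_l_exists a b : exists c, is_lcm_l (@Meq n) a b c.
Proof.
have [a' Ha] := Dp_multiple_l a; have [b' Hb] := Dp_multiple_l b.
apply: (@lcm_bounded _ a b (Dp (size a + size b)) (leqnn _)).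
  by exists (a' ++ Dp (size b)); rewrite catA Ha Dp_add.
by exists (b' ++ Dp (size a)); rewrite catA Hb addnC Dp_add.
Qed.

Lemma gcd_l_exists a b : exists g, is_gcd_l (@Meq n) a b g.
Proof.
apply: (@gcd_of_lcm _ ld weight ldiv_trans _ _ lcm_l_exists _ _ [::]).
- by move=> {}a {}b [c /weight_Meq <-]; rewrite weight_cat leq_addr.
- move=> {}a {}b [c Hc] nba; rewrite -(weight_Meq Hc) weight_cat -{1}[weight a]addn0.
  rewrite ltn_add2l lt0n; apply/eqP => /weight_eq0 c0; apply: nba.
  by exists [::]; rewrite -Hc c0 !cats0.
- by exists a.
- by exists b.
Qed.

(** * Lcms and gcds for right divisibility *)

Notation rd := (rdiv (@Meq n)).

(* If a a' = b b' = Delta^N then the left-lcm of a and b is the complement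
   in Delta^N of the left-gcd of a' and b'. *)
Lemma lcm_r_exists a b : exists c, is_lcm_r (@Meq n) a b c.
Proof.
pose N := size a + size b.
have [a' Ha] : exists a', a ++ a' =M Dp N.
  have [a' Ha] := Dp_multiple_l a; exists (a' ++ Dp (size b)).
  by rewrite catA Ha Dp_add.
have [b' Hb] : exists b', b ++ b' =M Dp N.
  have [b' Hb] := Dp_multiple_l b; exists (b' ++ Dp (size a)).
  by rewrite catA Hb /N addnC Dp_add.
have [g [[e He] [[e' He'] gmax]]] := gcd_l_exists a' b'.
have gc : g ++ e ++ a =M Dp N by rewrite catA He; apply: Dp_comm.
have gc' : g ++ e' ++ b =M Dp N by rewrite catA He'; apply: Dp_comm.
exists (e ++ a); split; first by exists e.
split; first by exists e'; apply: (@Meq_cancel_l g); rewrite gc gc'.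
move=> c [p Hp] [q Hq].
(* Cancelling [c] from [h] leaves a common divisor [t] of [a'] and [b'], so [h] divides [c ++ g].
   Delta^N divides [h], because c a' = p a a' = p Delta^N = Delta^N p, and likewise for [b']. *)
have [h [[ha Hha] [[hb Hhb] hmax]]] := gcd_l_exists (c ++ a') (c ++ b').
have [t Ht] : ld c h by apply: hmax; exact: ldiv_cat.
have tg : ld t g.
  by apply: gmax; rewrite -(ldiv_cat2l c) Ht; [exists ha | exists hb].
have [s Hs] : ld (Dp N) (c ++ g).
  apply: (@ldiv_trans _ h); last by rewrite -Ht ldiv_cat2l.
  apply: hmax; [exists p; rewrite -Hp -catA Ha | exists q; rewrite -Hq -catA Hb];
    exact: Dp_central.
exists s; apply: (@Meq_cancel_r g).
by rewrite -Hs -catA Dp_central (Dp_comm gc).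
Qed.

Lemma gcd_r_exists a b : exists g, is_gcd_r (@Meq n) a b g.
Proof.
apply: (@gcd_of_lcm _ rd weight _ _ _ lcm_r_exists _ _ [::]).
- move=> {}a {}b c [x Hx] [y Hy]; exists (y ++ x).
  by rewrite -catA Hx.
- by move=> {}a {}b [c /weight_Meq <-]; rewrite weight_cat leq_addl.
- move=> {}a {}b [c Hc] nba; rewrite -(weight_Meq Hc) weight_cat -{1}[weight a]add0n.
  rewrite ltn_add2r lt0n; apply/eqP => /weight_eq0 c0; apply: nba.
  by exists [::]; rewrite -Hc c0.
- by exists a; rewrite cats0.
- by exists b; rewrite cats0.
Qed.

(** * Finiteness and the Garside property *)

Lemma size_le_weight u : size u <= weight u.
Proof. by elim: u => //= a u IH; rewrite /weight /= -/(weight u); lia. Qed.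

(** A divisor of [c] weighs at most [weight c] and each letter at least 1, so its length is
    bounded. *)
Lemma finite_ldivisors c : exists s : seq (seq 'I_n),
  forall a, ld a c -> exists b, List.In b s /\ a =M b.
Proof.
exists (map val (enum {: {bseq (weight c) of 'I_n}})) => a [b Hb].
have Ha : size a <= weight c.
  by apply: leq_trans (size_le_weight a) _; rewrite -(weight_Meq Hb) weight_cat leq_addr.
exists a; split=> //; apply: mem_In.
by apply/mapP; exists (Bseq Ha); rewrite ?mem_enum.
Qed.

Lemma garside_Dp1 : garside (@Meq n) (Dp 1).
Proof.
split; first by split; [exact: Meq_cancel_l | exact: Meq_cancel_r].
split.
  exists weight; split; first exact: weight_Meq.
  split=> [a b|a na /weight_eq0 a0]; first by rewrite weight_cat.
  by apply: na; rewrite a0.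
split=> [a b|].
  split; first exact: lcm_l_exists.
  split; first exact: lcm_r_exists.
  by split; [exact: gcd_l_exists | exact: gcd_r_exists].
(* As Delta is central, the same cofactor works on the other side. *)
split=> [a|]; first by split=> -[b Hb]; exists b; apply: Dp_comm.
split; last exact: finite_ldivisors.
elim=> [|a w [ds [Hds Hw]]]; first by exists [::].
exists ([:: a] :: ds); split=> [d /= [<-|/Hds //]|]; last by rewrite /= Hw.
exists (Yp a.+1 ++ Xp (n - a.+1)).
by rewrite {1}(ord_rho a) rho_Y_X // ltn_ord.
Qed.

End Monoid.

(** * Presented groups and the torus knot group *)

Section Groups.
Variables (A : Type) (R : seq A -> seq A -> Prop).
Local Notation "u =G v" := (gcong R u v) (at level 70).

Lemma ginv_cat (u v : seq (A * bool)) : ginv (u ++ v) = ginv v ++ ginv u.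
Proof. by rewrite /ginv map_cat rev_cat. Qed.

Lemma ginvK (u : seq (A * bool)) : ginv (ginv u) = u.
Proof.
rewrite /ginv map_rev revK -map_comp -[RHS]map_id.
by apply: eq_map => -[a b] /=; rewrite negbK.
Qed.

Lemma gcong_mulV u : u ++ ginv u =G [::].
Proof.
elim: u => [|[a b] u IH]; first exact: mc_refl.
rewrite -cat1s ginv_cat catA -(catA _ u) /gcong IH.
exact/mc_rel/gr_inv.
Qed.

Lemma gcong_Vmul u : ginv u ++ u =G [::].
Proof. by rewrite -{2}(ginvK u); apply: gcong_mulV. Qed.

Lemma gcong_ginv u v : u =G v -> ginv u =G ginv v.
Proof.
move=> H; rewrite -[ginv u]cats0 /gcong -(gcong_mulV v) -{1}H catA.
by rewrite (gcong_Vmul u).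
Qed.

End Groups.

(** * Homomorphisms given on generators *)

Section Extension.
Variables (A B : Type) (f : A -> seq (B * bool)).

Lemma ext_cat u v : ext f (u ++ v) = ext f u ++ ext f v.
Proof. by rewrite /ext map_cat flatten_cat. Qed.

Lemma ext1 a b : ext f [:: (a, b)] = if b then f a else ginv (f a).
Proof. by rewrite /ext /= cats0. Qed.

Lemma ext_ginv w : ext f (ginv w) = ginv (ext f w).
Proof.
elim: w => // -[a b] w IH; rewrite -cat1s ginv_cat !ext_cat ginv_cat IH.
by case: b; rewrite !ext1 ?ginvK.
Qed.

Lemma ext_gcong (RA : seq A -> seq A -> Prop) (RB : seq B -> seq B -> Prop) w1 w2 :
  (forall u v, RA u v -> gcong RB (ext f (pos u)) (ext f (pos v))) ->
  gcong RA w1 w2 -> gcong RB (ext f w1) (ext f w2).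
Proof.
move=> Hf; elim=> {w1 w2} [_ _ [u v /Hf //|a b]|u|u v _ IH|u v w _ IH1 _ IH2|p u v s _ IH].
- rewrite /ext /= cats0; case: b => /=; first exact: gcong_mulV.
  exact: gcong_Vmul.
- exact: mc_refl.
- exact: mc_sym.
- exact: mc_trans IH1 IH2.
- by rewrite !ext_cat; apply: mc_ctx.
Qed.

End Extension.

Lemma ext_comp_id (A B : Type) (RA : seq A -> seq A -> Prop)
    (f : A -> seq (B * bool)) (g : B -> seq (A * bool)) w :
  (forall a, gcong RA (ext g (f a)) [:: (a, true)]) -> gcong RA (ext g (ext f w)) w.
Proof.
move=> H; elim: w => [|[a b] w IH]; first exact: mc_refl.
rewrite -cat1s ext_cat ext_cat /gcong IH; apply: mcong_cat => //.
rewrite ext1; case: b; first exact: H.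
by rewrite ext_ginv; apply: (gcong_ginv (H a)).
Qed.

(** With a a' = Delta, a letter a^-1 equals a' Delta^-1, and the central Delta^-1 passes through u:
    a^-1 u v^-1 = a' u (v Delta)^-1. *)
Lemma fractions m (g : seq ('I_m.+1 * bool)) :
  exists u v, gcong (@Mrel m.+1) g (pos u ++ ginv (pos v)).
Proof.
elim: g => [|[a b] g [u [v IH]]]; first by exists [::], [::]; apply: mc_refl.
have [a' Ha] := Dp_multiple_l [:: a].
case: b; first by exists (a :: u), v; rewrite /gcong IH.
exists (a' ++ u), (v ++ Dp m 1).
have E : gcong (@Mrel m.+1) (pos u ++ pos (Dp m 1)) (pos [:: a] ++ pos (a' ++ u)).
  rewrite -!pos_cat; apply: Meq_gcong.
  by rewrite /Meq -(Dp_central 1 u) -Ha catA.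
have F : gcong (@Mrel m.+1) (pos u)
    (pos [:: a] ++ pos (a' ++ u) ++ ginv (pos (Dp m 1))).
  by rewrite catA /gcong -E -catA (gcong_mulV _ (pos (Dp m 1))) cats0.
rewrite /gcong -cat1s IH F -[[:: (a, false)]]/(ginv (pos [:: a])).
rewrite -catA catA (gcong_Vmul _ (pos [:: a])) cat0s -catA.
by rewrite (pos_cat v) ginv_cat.
Qed.

(** * Isomorphism with the torus knot group *)

Section Torus.
Variable m : nat.
Local Notation n := m.+1.
Local Notation "u =T v" := (gcong (Trel n) u v) (at level 70).

Definition xs i : seq (bool * bool) := pos (nseq i false).
Definition ys i : seq (bool * bool) := pos (nseq i true).
Definition to_torus i : seq (bool * bool) := xs i ++ ginv (ys i).
Definition from_torus (b : bool) : seq ('I_n * bool) :=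
  if b then pos (Yp m 1) else pos (Xp m 1).

Lemma xs_add i j : xs (i + j) = xs i ++ xs j.
Proof. by rewrite /xs nseqD pos_cat. Qed.

Lemma ys_add i j : ys (i + j) = ys i ++ ys j.
Proof. by rewrite /ys nseqD pos_cat. Qed.

Lemma to_torus_n : to_torus n =T ys 1.
Proof.
have E : xs n =T ys n.+1 by apply/mc_rel/gr_rel.
rewrite /gcong /to_torus E -[n.+1]add1n ys_add -catA (gcong_mulV _ (ys n)).
by rewrite cats0.
Qed.

Lemma to_torus_y i : to_torus i.+1 ++ ys 1 =T xs i.+1 ++ ginv (ys i).
Proof.
rewrite /to_torus -[i.+1]add1n ys_add ginv_cat -!catA /gcong.
by rewrite (gcong_Vmul _ (ys 1)) cats0.
Qed.

(** Both sides reduce to x^(i+1) y^-i, because rho_n maps to x^n y^-n = y. *)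
Lemma to_torus_rel i :
  to_torus 1 ++ to_torus n ++ to_torus i =T to_torus i.+1 ++ to_torus n.
Proof.
rewrite /gcong to_torus_n catA (to_torus_y 0) (to_torus_y i).
by rewrite cats0 /to_torus catA -xs_add add1n.
Qed.

Lemma ext_from_xs i : ext from_torus (xs i) = pos (Xp m i).
Proof.
elim: i => // i IH; rewrite -[i.+1]add1n xs_add ext_cat IH Xp_add pos_cat.
by rewrite -[xs 1]/[:: (false, true)] ext1.
Qed.

Lemma ext_from_ys i : ext from_torus (ys i) = pos (Yp m i).
Proof.
elim: i => // i IH; rewrite -[i.+1]add1n ys_add ext_cat IH Yp_add pos_cat.
by rewrite -[ys 1]/[:: (true, true)] ext1.
Qed.

Lemma torus_iso : pres_group_iso (@Mrel n) (Trel n).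
Proof.
exists (fun a : 'I_n => to_torus a.+1), from_torus.
split; [|split; [|split]].
- move=> w1 w2; apply: ext_gcong => u v [i [Hi [Hu Hv]]].
  case: u Hu => [|a [|b [|c [|? ?]]]] //= [Ea Eb Ec].
  case: v Hv => [|a' [|b' [|? ?]]] //= [Ea' Eb'].
  change (to_torus a.+1 ++ to_torus b.+1 ++ to_torus c.+1 ++ [::] =T
          to_torus a'.+1 ++ to_torus b'.+1 ++ [::]).
  rewrite Ea Eb Ec Ea' Eb' !cats0 prednK; last by lia.
  exact: to_torus_rel.
- move=> w1 w2; apply: ext_gcong => u v [-> ->].
  rewrite -/(xs n) -/(ys n.+1) ext_from_xs ext_from_ys -Dp1.
  exact/Meq_gcong/XpnE.
- move=> w; apply: ext_comp_id => a.
  rewrite /to_torus ext_cat ext_ginv ext_from_xs ext_from_ys.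
  have Ha : 0 < a.+1 <= n by rewrite ltn_ord.
  have := Meq_gcong (XpE Ha); rewrite /gcong => ->.
  by rewrite -ord_rho -cat1s pos_cat -catA (gcong_mulV _ (pos (Yp m a.+1))).
(* There and back, y goes to rho_n and then to x^n y^-n = y, while x goes to rho_1 rho_n and then to
   x y^-1 y = x. *)
- have vn : rho m n = m :> nat by rewrite rho_val ?leqnn.
  have v1 : rho m 1 = 0 :> nat by rewrite rho_val.
  move=> w; apply: ext_comp_id => -[].
    change (to_torus (rho m n).+1 ++ [::] =T ys 1).
    by rewrite cats0 vn; apply: to_torus_n.
  change (to_torus (rho m 1).+1 ++ to_torus (rho m n).+1 ++ [::] =T xs 1).
  by rewrite cats0 vn v1 /gcong to_torus_n (to_torus_y 0).
Qed.

End Torus.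

Theorem theorem4p13 (n : nat) (hn : 0 < n) :
  garside (@Meq n) (Delta hn) /\
  (* M_n embeds in the group G(M_n) defined by the same presentation *)
  (forall u v : seq 'I_n, gcong (@Mrel n) (pos u) (pos v) -> Meq u v) /\
  (* G(M_n) is the group of (right) fractions of M_n *)
  (forall g : seq ('I_n * bool), exists u v : seq 'I_n,
      gcong (@Mrel n) g (pos u ++ ginv (pos v))) /\
  (* G(M_n) is isomorphic to the (n, n+1)-torus knot group *)
  pres_group_iso (@Mrel n) (Trel n).
Proof.
case: n hn => // m hn.
have -> : Delta hn = Dp m 1.
  rewrite Dp1 /Delta /Yp; congr nseq; apply: val_inj.
  by rewrite rho_val ?leqnn.
split; first exact: garside_Dp1.
split; first exact: gcong_Meq.
by split; [exact: fractions | exact: torus_iso].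
Qed.
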